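(* If $S$ and $T$ are dual equivalent standard skew tableaux (of the same skew shape, whose row lengths weakly decrease from top to bottom), then $\operatorname{stab}(S)=\operatorname{stab}(T)$.
   Context: The reading word of a skew tableau reads each row left to right, from the bottom row to the top row. For an integer $i$, the elementary dual equivalence move $d_i$ on a standard skew tableau swaps the entries $i$ and $i\pm1$ (leaving all else fixed) provided the entry $i\mp1$ lies between them in the reading word; if no such configuration occurs, $d_i$ does nothing. Two standard skew tableaux are dual equivalent if one is obtained from the other by a sequence of elementary dual equivalence moves. $\operatorname{Rect}$ is jeu de taquin rectification. For a standard skew tableau $S$ with $m$ cells whose row lengths weakly decrease from top to bottom and $k\ge1$, $S^{(k)}$ is obtained by attaching $k-1$ shifted copies of $S$ to the right of $S$: row $i$ of $S^{(k)}$ begins in the same column as row $i$ of $S$ and consists of the entries of row $i$ of $S$, followed by these entries plus $m$, ..., followed by these entries plus $(k-1)m$. $S$ stabilizes at $k$ if every entry in $[(k-1)m+1,km]$ lies in the same row of $\operatorname{Rect}(S^{(k)})$ as in $S^{(k)}$; $\operatorname{stab}(S)$ is the least $k\ge1$ at which $S$ stabilizes. *)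

(* Defs.v *)
From mathcomp Require Import all_boot.
Set Implicit Arguments. Unset Strict Implicit. Unset Printing Implicit Defensive.

(* A skew tableau of shape lambda/mu (English convention, row 0 on top) is a
   pair (mu, rows): row i occupies columns nth 0 mu i, ...,
   nth 0 mu i + size (nth [::] rows i) - 1, with entries nth [::] rows i. *)
Definition tab := (seq nat * seq (seq nat))%type.

Definition inner (T : tab) : seq nat := T.1.
Definition trows (T : tab) : seq (seq nat) := T.2.
Definition rowT (T : tab) (i : nat) : seq nat := nth [::] (trows T) i.
Definition offs (T : tab) (i : nat) : nat := nth 0 (inner T) i.

Definition in_cell (T : tab) (i j : nat) : bool :=
  (offs T i <= j) && (j < offs T i + size (rowT T i)).
Definition entry (T : tab) (i j : nat) : nat := nth 0 (rowT T i) (j - offs T i).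

Definition is_skew_shape (T : tab) : Prop :=
  size (inner T) = size (trows T) /\
  (forall i, offs T i.+1 <= offs T i) /\
  (forall i, offs T i.+1 + size (rowT T i.+1) <= offs T i + size (rowT T i)).

Definition reading_word (T : tab) : seq nat := flatten (rev (trows T)).
Definition ncells (T : tab) : nat := size (reading_word T).

Definition standard_skew (T : tab) : Prop :=
  is_skew_shape T /\
  perm_eq (reading_word T) (iota 1 (ncells T)) /\
  (forall i, sorted ltn (rowT T i)) /\
  (forall i j, in_cell T i j -> in_cell T i.+1 j -> entry T i j < entry T i.+1 j).

Definition rows_weakly_decreasing (T : tab) : Prop :=
  forall i, size (rowT T i.+1) <= size (rowT T i).

Definition same_shape (S T : tab) : Prop :=
  inner S = inner T /\ map size (trows S) = map size (trows T).

Definition swapv (a b x : nat) : nat :=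
  if x == a then b else if x == b then a else x.
Definition swap_entries (a b : nat) (T : tab) : tab :=
  (inner T, map (map (swapv a b)) (trows T)).

Definition between (w : seq nat) (a b c : nat) : bool :=
  ((index a w < index b w) && (index b w < index c w)) ||
  ((index c w < index b w) && (index b w < index a w)).

(* d_i for an integer i (only i >= 1 can act nontrivially since entries are
   positive; for i = 0 the move does nothing as the value i-1 is absent) *)
Definition dual_move (i : nat) (T : tab) : tab :=
  let w := reading_word T in
  if [&& 1 < i, (i.-1 \in w), (i \in w), (i.+1 \in w) & between w i i.-1 i.+1]
  then swap_entries i i.+1 T
  else if [&& 1 < i, (i.-1 \in w), (i \in w), (i.+1 \in w) & between w i i.+1 i.-1]
  then swap_entries i i.-1 T
  else T.

Inductive dual_equiv : tab -> tab -> Prop :=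
  | de_refl T : dual_equiv T T
  | de_step S T i : dual_equiv S T -> dual_equiv S (dual_move i T).

Definition upd (G : nat -> nat -> nat) (r c v : nat) : nat -> nat -> nat :=
  fun i j => if (i == r) && (j == c) then v else G i j.

(* forward slide of the hole at (r,c); G i j = 0 means "no cell" *)
Fixpoint slide (fuel r c : nat) (G : nat -> nat -> nat) : nat -> nat -> nat :=
  match fuel with
  | 0 => G
  | f.+1 =>
    let a := G r c.+1 in
    let b := G r.+1 c in
    if (a == 0) && (b == 0) then G
    else if (b == 0) || ((a != 0) && (a < b))
    then slide f r c.+1 (upd (upd G r c a) r c.+1 0)
    else slide f r.+1 c (upd (upd G r c b) r.+1 c 0)
  end.

Fixpoint rect_loop (fuel m : nat) (mu : seq nat) (G : nat -> nat -> nat)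
  : nat -> nat -> nat :=
  match fuel with
  | 0 => G
  | f.+1 =>
    match [seq i <- iota 0 (size mu) | 0 < nth 0 mu i] with
    | [::] => G
    | i0 :: idx =>
      let r := last i0 idx in
      let c := (nth 0 mu r).-1 in
      rect_loop f m (set_nth 0 mu r c) (slide m.+1 r c G)
    end
  end.

Definition tab_fun (T : tab) : nat -> nat -> nat :=
  fun i j => if in_cell T i j then entry T i j else 0.

Definition rect (T : tab) : seq (seq nat) :=
  let m := ncells T in
  let G := rect_loop (sumn (inner T)).+1 m (inner T) (tab_fun T) in
  [seq [seq G i j | j <- iota 0 m & G i j != 0] | i <- iota 0 (size (trows T))].

Definition tab_power (T : tab) (k : nat) : tab :=
  let m := ncells T in
  (inner T, [seq flatten [seq map (addn (t * m)) r | t <- iota 0 k] | r <- trows T]).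

Definition stabilizes_at (S : tab) (k : nat) : Prop :=
  let m := ncells S in
  let Sk := tab_power S k in
  forall x, (k.-1) * m < x <= k * m ->
    forall i, (x \in nth [::] (rect Sk) i) = (x \in rowT Sk i).

Definition is_stab (S : tab) (k : nat) : Prop :=
  1 <= k /\ stabilizes_at S k /\ (forall k', 1 <= k' < k -> ~ stabilizes_at S k').

(* Main.v *)
(** Record a standard skew tableau by its row word, whose x-th letter is the row
    of the entry x.  An elementary dual equivalence move is then a Knuth move on
    three consecutive letters.  Running a jeu de taquin slide through the entries
    in increasing order turns it into a finite-state transducer on row words,
    whose state is the shape filled so far together with the row of the hole; this
    transducer commutes with Knuth moves, hence so does rectification.

    The row word of S^(k) is the k-th power of the row word y of S, and S
    stabilizes at k iff rectification preserves the last copy of y.  A Knuth move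
    on y lifts to one Knuth move in each copy, and the one in the last copy acts on
    the last block of the rectified word as it does on y.  Since Knuth moves are
    involutions, the last block equals y before the move iff it does after. *)

Require Import Defs.
From mathcomp Require Import all_boot zify.
From Stdlib Require Import FunctionalExtensionality.
Set Implicit Arguments. Unset Strict Implicit. Unset Printing Implicit Defensive.

Implicit Types (la : nat -> nat) (w u v : seq nat) (G : nat -> nat -> nat).

Lemma funext2 G G' : G =2 G' -> G = G'.
Proof. by move=> E; apply: functional_extensionality => i; apply: functional_extensionality. Qed.

(** * Row words and Knuth moves *)

Definition add_box la r i := la i + (i == r).
Definition del_box la r i := la i - (i == r).

Lemma add_boxAC la b c : add_box (add_box la b) c = add_box (add_box la c) b.
Proof. by apply: functional_extensionality => i; rewrite /add_box; lia. Qed.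

(* The entries 1, 2, ... placed at the ends of the rows given by w, starting from
   the shape la, form a standard filling: every intermediate shape is a partition. *)
Definition lattice la w := forall n i,
  la i.+1 + count_mem i.+1 (take n w) <= la i + count_mem i (take n w).

Lemma lattice_partition la w : lattice la w -> forall i, la i.+1 <= la i.
Proof. by move=> H i; have := H 0 i; rewrite take0 /= !addn0. Qed.

Lemma lattice_cons la r w :
  lattice la (r :: w) <-> (forall i, la i.+1 <= la i) /\ lattice (add_box la r) w.
Proof.
split=> [H|[H0 H] [|n] i].
- split; first exact: lattice_partition H.
  by move=> n i; have := H n.+1 i; rewrite /add_box /= -!addnA ![_ == r]eq_sym.
- by rewrite take0 /= !addn0.
- by have := H n i; rewrite /add_box /= -!addnA ![_ == r]eq_sym.
Qed.

Lemma lattice_cat la u v : lattice la u ->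
  lattice (fun i => la i + count_mem i u) v -> lattice la (u ++ v).
Proof.
move=> Hu Hv n i; rewrite take_cat; case: ifP => _; first exact: Hu.
by rewrite !count_cat !addnA; exact: Hv.
Qed.

Lemma lattice_shift la d w : (forall i, d i.+1 <= d i) -> lattice la w ->
  lattice (fun i => la i + d i) w.
Proof. by move=> Hd H n i; have := H n i; have := Hd i; lia. Qed.

Definition wpow w k := flatten (nseq k w).

Lemma wpowSr w k : wpow w k.+1 = wpow w k ++ w.
Proof. by rewrite /wpow -addn1 nseqD flatten_cat /= cats0. Qed.

Lemma size_wpow w k : size (wpow w k) = k * size w.
Proof. by elim: k => //= k IH; rewrite wpowSr size_cat IH; lia. Qed.

Lemma all_wpow (p : pred nat) w k : all p w -> all p (wpow w k).
Proof. by move=> H; elim: k => //= k IH; rewrite wpowSr all_cat IH. Qed.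

(** Weakly decreasing row lengths enter here: each new copy of [w] starts from [la] plus a
    partition, which [lattice_shift] absorbs. *)
Lemma lattice_wpow la w k : lattice la w ->
  (forall i, count_mem i.+1 w <= count_mem i w) -> lattice la (wpow w k).
Proof.
move=> H D; elim: k => [|k IH].
  by move=> n i; have := lattice_partition H i; rewrite /wpow /= !addn0.
rewrite wpowSr; apply: lattice_cat => //; apply: lattice_shift => // i.
by elim: k {IH} => //= k IH; rewrite wpowSr !count_cat leq_add.
Qed.

(* The move d_(p+2) on row words: a precedes b in the reading word iff the row of a
   is lower, or the rows agree and a < b. *)
Fixpoint knuth p w : seq nat :=
  match p, w with
  | p'.+1, x :: w' => x :: knuth p' w'
  | 0, [:: x, y, z & w'] =>
    if (z <= x < y) || (y <= x < z) then [:: x, z, y & w']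
    else if (x < z <= y) || (y < z <= x) then [:: y, x, z & w']
    else w
  | _, _ => w
  end.

(** Each swap condition is symmetric in the two letters it exchanges, and the two conditions exclude
    each other. *)
Lemma knuthK p : involutive (knuth p).
Proof.
elim: p => [|p IH] [|x w] //=; last by rewrite IH.
case: w => [|y [|z w]] //=.
case: ifP => [H|H]; first by rewrite /= orbC H.
by case: ifP => [H'|H'] /=; case: ifP => K; try (exfalso; lia); case: ifP => K' //; exfalso; lia.
Qed.

Lemma perm_knuth p w : perm_eq (knuth p w) w.
Proof.
elim: p w => [|p IH] [|x w] //=; last by rewrite perm_cons.
case: w => [|y [|z w]] //=.
case: ifP => _; last case: ifP => _ //.
- by rewrite perm_cons (perm_catCA [:: z] [:: y] w).
- by rewrite (perm_catCA [:: y] [:: x] (z :: w)).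
Qed.

Lemma size_knuth p w : size (knuth p w) = size w.
Proof. exact/perm_size/perm_knuth. Qed.

Lemma knuth_cat_right p u v : knuth (size u + p) (u ++ v) = u ++ knuth p v.
Proof. by elim: u => //= x u ->. Qed.

Lemma knuth_cat_left p u v : p + 2 < size u -> knuth p (u ++ v) = knuth p u ++ v.
Proof.
elim: p u => [|p IH] [|x u] //= H; last by rewrite IH //; lia.
by case: u H => [|y [|z u]] //= _; case: ifP => // _; case: ifP.
Qed.

Lemma knuth_short p w : size w <= p + 2 -> knuth p w = w.
Proof.
elim: p w => [|p IH] [|x w] //= H; last by rewrite IH //; lia.
by case: w H => [|y [|z w]].
Qed.

(** Only one intermediate shape changes. It could fail only by extending row i+1 before row i when
    both have equal length; but then the third letter is an i that comes first or an i+1 that comes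
    last, and the known partitions rule this out. *)
Lemma lattice_knuth la p w : lattice la w -> lattice la (knuth p w).
Proof.
elim: p la w => [|p IH] la [|x w] //=; last first.
  by rewrite !lattice_cons => -[H0 H]; split=> //; exact: IH.
case: w => [|y [|z w]] //= H.
have := H; rewrite !lattice_cons => -[H0 [H1 [H2 H3]]].
have H4 := lattice_partition H3.
case: ifP => [K|_]; last case: ifP => [K|_] //; rewrite !lattice_cons;
  (do ?split => //); try (by rewrite ?[add_box (add_box _ z) y]add_boxAC ?[add_box (add_box _ y) x]add_boxAC);
  by move=> i; move: (H0 i) (H1 i) (H2 i) (H4 i); rewrite /add_box; lia.
Qed.

(** * A slide as a transducer on row words *)

(* The hole sits at the end of row a of the filled shape la.  An entry added to row
   a follows the hole to the left; one added to row a.+1 moves up into row a iff it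
   lands right below the hole; any other entry stays. *)
Definition hole_out la a r :=
  if (r == a) || ((r == a.+1) && ((la a.+1).+1 == la a)) then a else r.
Definition hole_next la a r :=
  if (r == a.+1) && ((la a.+1).+1 == la a) then a.+1 else a.

Fixpoint slidew la a w : seq nat :=
  if w is r :: w' then
    hole_out la a r :: slidew (add_box la r) (hole_next la a r) w'
  else [::].

Lemma size_slidew la a w : size (slidew la a w) = size w.
Proof. by elim: w la a => //= r w IH la a; rewrite IH. Qed.

Lemma all_slidew N la a w : all (gtn N) w -> all (gtn N) (slidew la a w).
Proof.
elim: w la a => //= r w IH la a /andP[H /IH ->]; rewrite andbT /hole_out.
by case: ifP => // K; lia.
Qed.

(** The invariant of every induction along [slidew]: the hole stays at a corner of the growing
    shape, and the output fills that shape minus the hole. *)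
Lemma hole_step la a r : (forall i, la i.+1 <= la i) ->
  (forall i, add_box la r i.+1 <= add_box la r i) -> la a.+1 < la a ->
  add_box la r (hole_next la a r).+1 < add_box la r (hole_next la a r)
  /\ add_box (del_box la a) (hole_out la a r) = del_box (add_box la r) (hole_next la a r).
Proof.
move=> H0 H1 Ha; split.
  rewrite /hole_next; move: (H0 a) (H1 a) (H0 a.+1) (H1 a.+1); rewrite /add_box.
  by case: ifP; lia.
apply: functional_extensionality => i; move: (H0 a); rewrite /add_box /del_box /hole_next /hole_out.
case: (altP (i =P a)) => [->|]; do 2?case: ifP; try lia.
Qed.

Lemma lattice_slidew la a w : lattice la w -> la a.+1 < la a ->
  lattice (del_box la a) (slidew la a w).
Proof.
elim: w la a => [|r w IH] la a /=.
  move=> H Ha n i; rewrite /del_box /= !addn0; have := lattice_partition H i.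
  by case: (i =P a) => [->|]; lia.
rewrite lattice_cons => -[H0 H] Ha.
have [Hb E] := hole_step H0 (lattice_partition H) Ha.
rewrite lattice_cons E; split; last exact: IH.
by move=> i; rewrite /del_box; have := H0 i; case: (i =P a) => [->|]; lia.
Qed.

Variant hole_spec la a r : nat -> nat -> Prop :=
| HoleRight of r = a : hole_spec la a r a a
| HoleDown of r = a.+1 & (la a.+1).+1 = la a : hole_spec la a r a a.+1
| HoleStay of r <> a & ~ (r = a.+1 /\ (la a.+1).+1 = la a) : hole_spec la a r r a.

Lemma holeP la a r : hole_spec la a r (hole_out la a r) (hole_next la a r).
Proof.
rewrite /hole_out /hole_next.
case: (r =P a) => [->|Ha] /=; first by case: ifP => H; [lia | constructor].
case: ifP => H; first by constructor; lia.
by constructor; lia.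
Qed.

(** The guard makes the case analysis follow the order of insertion: a step is split only once the
    row of its hole contains no pending [hole_next]. *)
Ltac hole_step_tac :=
  match goal with |- context [hole_out ?l ?b ?r] =>
    lazymatch b with context [hole_next] => fail | _ =>
    case: (holeP l b r) => [?|? ?|? ?]; try (exfalso; unfold add_box in *; lia) end end.

(** An output is the letter or one less. The comparison could change only for a followed by a lifted
    a+1, which contradicts the corner condition at a, or for a lifted a+1 followed by another a+1,
    which contradicts the partition condition after y. *)
Lemma hole_descent la a x y : la a.+1 < la a ->
  (forall i, add_box la x i.+1 <= add_box la x i) ->
  (forall i, add_box (add_box la x) y i.+1 <= add_box (add_box la x) y i) ->
  (hole_out la a x < hole_out (add_box la x) (hole_next la a x) y) = (x < y).
Proof.
move=> Ha H1 H2; move: (H1 a) (H1 a.+1) (H2 a) (H2 a.+1) => {}H1 H1' {}H2 H2'.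
do 2?hole_step_tac; unfold add_box in *; lia.
Qed.

(* In the excluded case the larger letter lands below the hole exactly when it is
   added before the smaller one. *)
Lemma hole_commute la a x y : la a.+1 < la a -> x < y ->
  (forall i, add_box la y i.+1 <= add_box la y i) ->
  ~~ [&& x == a, y == a.+1 & (la a.+1).+1 == la a] ->
  let ax := hole_next la a x in let ay := hole_next la a y in
  [/\ hole_out (add_box la y) ay x = hole_out la a x,
      hole_out (add_box la x) ax y = hole_out la a y &
      hole_next (add_box la y) ay x = hole_next (add_box la x) ax y].
Proof.
move=> Ha Hxy H1 N; move: (H1 a) (H1 a.+1) => {}H1 H1' /=.
rewrite {1}/add_box {1}/add_box in H1; rewrite {1}/add_box {1}/add_box in H1'.
do 4?hole_step_tac; split; lia.
Qed.

(* By [hole_descent] the outputs have the same descents as the inputs, and a Knuth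
   move applies exactly when one of the two comparisons is a descent x < y. *)
Lemma slidew_knuth_descent la a x y z w : la a.+1 < la a ->
  lattice la [:: x, y, z & w] -> x < y -> z <= y ->
  slidew la a (knuth 0 [:: x, y, z & w]) = knuth 0 (slidew la a [:: x, y, z & w]).
Proof.
move=> Ha H Hxy Hzy.
have := lattice_knuth 0 H; move: (H); rewrite !lattice_cons => -[H0 [H1 [H2 _]]].
have [Hb Eb] := hole_step H0 H1 Ha.
have Dxy := hole_descent Ha H1 H2; rewrite Hxy in Dxy.
have [Hzx|Hxz] := leqP z x.
  have -> : knuth 0 [:: x, y, z & w] = [:: x, z, y & w] by rewrite /= Hzx Hxy.
  rewrite !lattice_cons => -[_ [_ [H3 _]]].
  have Dxz := hole_descent Ha H1 H3.
  have [||E1 E2 E3] := hole_commute (y := y) (x := z) Hb _ H2; first by lia.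
    (* Here z <= x < y = z+1 forces x = z, the row of the hole; the equality [E] then contradicts
       the corner condition at a or the partition condition after x and z. *)
    apply/negP => /and3P[/eqP Ez /eqP Ey /eqP E].
    move: (H1 a) (H3 a) E Hb => {H0 H1 H2 H3 Eb Dxy Dxz}.
    move: Ez Ey; case: holeP => *; unfold add_box in *; lia.
  rewrite /= E1 E2 E3 [add_box (add_box _ z) y]add_boxAC.
  by rewrite Dxy ifT //; lia.
have -> : knuth 0 [:: x, y, z & w] = [:: y, x, z & w].
  by rewrite /= Hxz Hzy; case: ifP => // ?; lia.
rewrite !lattice_cons => -[_ [H3 [H4 /lattice_partition H5]]].
have [/and3P[/eqP Ex /eqP Ey /eqP E]|N] := boolP [&& x == a, y == a.+1 & (la a.+1).+1 == la a].
  (* Here the Knuth move changes type: a, a+1, a+1 slides to a, a+1, a. *)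
  have Ez : z = y by lia.
  rewrite Ez Ex Ey /= [add_box (add_box _ a) a.+1]add_boxAC.
  have [-> ->] : hole_out la a a = a /\ hole_next la a a = a by case: holeP; lia.
  have [-> ->] : hole_out la a a.+1 = a /\ hole_next la a a.+1 = a.+1 by case: holeP; lia.
  have [-> ->] : hole_out (add_box la a) a a.+1 = a.+1 /\ hole_next (add_box la a) a a.+1 = a.
    by case: holeP; rewrite /add_box; lia.
  have [-> ->] : hole_out (add_box (add_box la a) a.+1) a a.+1 = a /\
                 hole_next (add_box (add_box la a) a.+1) a a.+1 = a.+1.
    by case: holeP; rewrite /add_box; lia.
  have [-> ->] : hole_out (add_box la a.+1) a.+1 a = a /\ hole_next (add_box la a.+1) a.+1 a = a.+1.
    by case: holeP; rewrite /add_box; lia.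
  have [-> ->] : hole_out (add_box (add_box la a.+1) a) a.+1 a.+1 = a.+1 /\
                 hole_next (add_box (add_box la a.+1) a) a.+1 a.+1 = a.+1.
    by case: holeP; rewrite /add_box; lia.
  by rewrite leqnn ltnS leqnn [add_box (add_box _ a.+1) a]add_boxAC [add_box (add_box la a.+1) a]add_boxAC.
have [E1 E2 E3] := hole_commute Ha Hxy H3 N.
have [Hc Ec] := hole_step H0 H3 Ha.
have Dxz := hole_descent Hc H4 H5.
have Dyz : (forall i, add_box (add_box (add_box la x) y) z i.+1 <= add_box (add_box (add_box la x) y) z i).
  by move=> i; rewrite [add_box (add_box _ x) y]add_boxAC; exact: H5.
have {}Dyz := hole_descent Hb H2 Dyz.
rewrite [add_box (add_box _ y) x]add_boxAC E1 E3 Hxz in Dxz.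
rewrite /= E1 E2 E3 [add_box (add_box _ y) x]add_boxAC.
rewrite -E2 in Dxy Dyz *.
rewrite ifF ?ifT //; lia.
Qed.

Lemma knuth_id x y z w : (x < y) = (y < z) ->
  knuth 0 [:: x, y, z & w] = [:: x, y, z & w].
Proof. by move=> E /=; case: ifP => ?; [lia | case: ifP => // ?; lia]. Qed.

(** Letters before the move are stripped by induction. If the two adjacent comparisons agree, both
    sides are fixed; otherwise the word or its Knuth image starts with x < y, where
    [slidew_knuth_descent] applies. *)
Lemma slidew_knuth la a p w : lattice la w -> la a.+1 < la a ->
  slidew la a (knuth p w) = knuth p (slidew la a w).
Proof.
elim: p la a w => [|p IH] la a [|x w] //; last first.
  rewrite /= lattice_cons => -[H0 H] Ha.
  by rewrite IH //; have [] := hole_step H0 (lattice_partition H) Ha.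
case: w => [|y [|z w]] // H Ha.
have [E|NE] := eqVneq (x < y) (y < z).
  move: (H); rewrite !lattice_cons => -[H0 [H1 [H2 H3]]].
  have [Hb _] := hole_step H0 H1 Ha.
  rewrite knuth_id // [RHS]knuth_id // !hole_descent //.
  exact: lattice_partition H3.
have [Hxy|Hyx] := ltnP x y; first by apply: slidew_knuth_descent => //; lia.
set v := [:: x, y, z & w].
suff K v' : knuth 0 v = v' -> slidew la a v' = knuth 0 (slidew la a v) by exact: K.
(* [knuth 0] swaps the two descent patterns, so its involutivity reduces to the previous lemma. *)
move=> E; have Hv : lattice la v' by rewrite -E; exact: lattice_knuth.
rewrite -(knuthK 0 v) E -[LHS](knuthK 0); congr knuth.
move: E Hv; rewrite /v [knuth _ _]/=.
have -> : (z <= x < y) = false by lia.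
have -> : (x < z <= y) = false by lia.
have -> : y <= x < z = (x < z) by lia.
have -> : y < z <= x = (z <= x) by lia.
by case: ltnP => Hxz <- Hv; rewrite slidew_knuth_descent //; lia.
Qed.

(** * Slides of tableaux *)

Fixpoint fill la n w : nat -> nat -> nat := fun i j =>
  if w is r :: w' then
    if (i == r) && (j == la r) then n else fill (add_box la r) n.+1 w' i j
  else 0.

Lemma fill_geq la n w i j : fill la n w i j = 0 \/ n <= fill la n w i j.
Proof.
elim: w la n => [|r w IH] la n /=; first by left.
case: ifP => _; first by right.
by have [->|H] := IH (add_box la r) n.+1; [left | right; lia].
Qed.

Lemma fill_inside la n w i j : j < la i -> fill la n w i j = 0.
Proof.
elim: w la n => [|r w IH] la n //= H; case: ifP => [|_]; last by rewrite IH // /add_box; lia.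
by case/andP=> /eqP E /eqP E'; subst; lia.
Qed.

(* A tableau in the middle of a slide: G holds the entries below n, inside la. *)
Definition glue la G n w i j := if j < la i then G i j else fill la n w i j.

Lemma glue_outside la G n w i j : la i <= j -> glue la G n w i j = fill la n w i j.
Proof. by rewrite /glue ltnNge => ->. Qed.

Lemma eq_glue la G G' n w : (forall i j, j < la i -> G i j = G' i j) ->
  glue la G n w = glue la G' n w.
Proof. by move=> E; apply: funext2 => i j; rewrite /glue; case: ifP => // /E. Qed.

Lemma glue_cons la G n r w :
  glue la G n (r :: w) = glue (add_box la r) (upd G r (la r) n) n.+1 w.
Proof.
apply: funext2 => i j; rewrite /glue /upd /= /add_box.
case: (i =P r) => [->|_] /=; last by rewrite addn0.
by rewrite addn1 ltnS; case: ltngtP.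
Qed.

(** The right and lower neighbours of the hole lie outside [la], so they hold 0 or entries at least
    n. If n is one of them it is the smaller and moves into the hole; otherwise n joins the filled
    part and no fuel is spent. Hence [size w < f] suffices. *)
Lemma slide_glue f la a G n w :
  lattice la w -> la a.+1 < la a -> G a (la a).-1 = 0 -> 0 < n -> size w < f ->
  slide f a (la a).-1 (glue la G n w) = glue (del_box la a) G n (slidew la a w).
Proof.
elim: w f la a G n => [|r w IH] [|f] la a G n //= H Ha HG Hn Hf.
  have Pa : (la a).-1.+1 = la a by lia.
  rewrite Pa !glue_outside //=; last by lia.
  apply: funext2 => i j; rewrite /glue /del_box.
  case: (i =P a) => [->|_]; last by rewrite subn0.
  rewrite subn1; case: ltnP => K; case: ltnP => K' //=; last by lia.
  by have -> : j = (la a).-1 by lia.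
have Pa : (la a).-1.+1 = la a by lia.
have [H0 Hw] : (forall i, la i.+1 <= la i) /\ lattice (add_box la r) w by apply/lattice_cons.
have Hp := lattice_partition Hw.
have [Hb E] := hole_step H0 Hp Ha.
have IHw f' G' := IH f' _ (hole_next la a r) G' n.+1 Hw Hb.
rewrite [RHS]glue_cons E; move: Hb E IHw; case: holeP => [->|-> E1|N1 N2] Hb E IHw.
- have -> : (glue la G n (a :: w)) a (la a).-1.+1 = n.
    by rewrite Pa glue_outside //= !eqxx.
  set b := glue _ _ _ _ _ _.
  have Eb : b = 0 \/ n < b.
    rewrite /b glue_outside /=; last by lia.
    rewrite ifF; last by lia.
    by have [->|] := fill_geq (add_box la a) n.+1 w a.+1 (la a).-1; [left|right].
  rewrite ifF; last by lia.
  rewrite ifT; last by lia.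
  have Ea : (add_box la a a).-1 = la a by rewrite /add_box eqxx; lia.
  transitivity (slide f a (add_box la a a).-1
      (glue (add_box la a) (upd (upd G a (la a).-1 n) a (la a) 0) n.+1 w)).
    rewrite Ea Pa glue_cons; congr slide; apply: funext2 => i j.
    rewrite /glue /upd /add_box.
    case: (i =P a) => [->|_] /=; last by rewrite addn0.
    rewrite addn1; case: (j =P la a) => [->|Hj]; first by rewrite ltnSn.
    by case: (j =P (la a).-1) => [->|//]; rewrite ifT //; lia.
  rewrite IHw ?Ea //; last by rewrite /upd !eqxx.
  (* The emptied cell is the corner that [del_box] discards, so the 0 written there is invisible. *)
  apply: eq_glue => i j; rewrite /upd /del_box /add_box.
  case: (i =P a) => [->|] //=; rewrite eqxx addn1 !subn1 /= => Hj.
  by case: (j =P la a) => //; lia.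
- have -> : (glue la G n (a.+1 :: w)) a.+1 (la a).-1 = n.
    by rewrite glue_outside /=; [rewrite ifT //; lia | lia].
  set c := glue _ _ _ _ _ _.
  have Ec : c = 0 \/ n < c.
    rewrite /c glue_outside /=; last by lia.
    rewrite ifF; last by lia.
    by have [->|] := fill_geq (add_box la a.+1) n.+1 w a (la a).-1.+1; [left|right].
  rewrite ifF; last by lia.
  rewrite ifF; last by lia.
  have Ea : (add_box la a.+1 a.+1).-1 = (la a).-1 by rewrite /add_box eqxx; lia.
  transitivity (slide f a.+1 (add_box la a.+1 a.+1).-1
      (glue (add_box la a.+1) (upd (upd G a (la a).-1 n) a.+1 (la a).-1 0) n.+1 w)).
    rewrite Ea glue_cons; congr slide; apply: funext2 => i j.
    rewrite /glue /upd /add_box.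
    case: (i =P a.+1) => [->|Hi] /=.
      rewrite addn1; case: (j =P (la a).-1) => [->|Hj]; first by rewrite ifT //; lia.
      by rewrite !andbF; have -> : (j == la a.+1) = false by lia.
    rewrite addn0; case: (i =P a) => [->|//] /=.
    by case: (j =P (la a).-1) => [->|//]; rewrite ifT //; lia.
  rewrite IHw ?Ea //; last by rewrite /upd !eqxx.
  apply: eq_glue => i j; rewrite /upd /del_box /add_box eqxx subn1.
  case: (i =P a.+1) => [->|Hi] //= Hj.
  by rewrite ifF ?ifF //; lia.
- have Ea : (add_box la r a).-1 = (la a).-1 by rewrite /add_box; lia.
  (* The slide has not moved yet, so it keeps its full fuel. *)
  transitivity (slide f.+1 a (add_box la r a).-1 (glue (add_box la r) (upd G r (la r) n) n.+1 w)).
    by rewrite -glue_cons Ea.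
  rewrite IHw ?Ea /upd; [ | by rewrite ifF //; lia | by [] | by lia].
  by apply: eq_glue => i j; rewrite /upd /del_box; have -> : la r - (r == a) = la r by lia.
Qed.

(** * Rectification of row words *)

Lemma last_filter_iota (P : pred nat) n i0 s :
  [seq i <- iota 0 n | P i] = i0 :: s ->
  [/\ last i0 s < n, P (last i0 s) & forall i, last i0 s < i < n -> ~~ P i].
Proof.
elim: n i0 s => [|n IH] i0 s //; rewrite -addn1 iotaD filter_cat /=.
case: ifP => Pn.
  rewrite cats1 => E; have -> : last i0 s = n by rewrite -(last_cons 0) -E last_rcons.
  by split=> // [|i]; lia.
rewrite cats0 => /IH [H1 H2 H3]; split=> // [|i Hi]; first by lia.
have [->|Hin] := eqVneq i n; first by rewrite Pn.
by apply: H3; lia.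
Qed.

(** Mirrors [rect_loop]: the inner shape is the initial filled shape of the transducer, and its
    lowest corner is the hole. *)
Fixpoint rectw f mu w : seq nat :=
  if f is f'.+1 then
    if [seq i <- iota 0 (size mu) | 0 < nth 0 mu i] is i0 :: s then
      let r := last i0 s in
      rectw f' (set_nth 0 mu r (nth 0 mu r).-1) (slidew (nth 0 mu) r w)
    else w
  else w.

Lemma size_rectw f mu w : size (rectw f mu w) = size w.
Proof.
by elim: f mu w => //= f IH mu w; case: filter => // *; rewrite IH size_slidew.
Qed.

Lemma all_rectw N f mu w : all (gtn N) w -> all (gtn N) (rectw f mu w).
Proof.
elim: f mu w => //= f IH mu w H; case: filter => // *.
by apply: IH; exact: all_slidew.
Qed.

Lemma nth_remove_box mu r : nth 0 (set_nth 0 mu r (nth 0 mu r).-1) = del_box (nth 0 mu) r.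
Proof.
apply: functional_extensionality => i; rewrite nth_set_nth /= /del_box.
by case: eqP => [->|_]; rewrite ?subn1 ?subn0.
Qed.

Lemma lowest_row_corner mu i0 s :
  [seq i <- iota 0 (size mu) | 0 < nth 0 mu i] = i0 :: s ->
  nth 0 mu (last i0 s).+1 < nth 0 mu (last i0 s).
Proof.
move/last_filter_iota => [H1 H2 H3]; apply: leq_ltn_trans H2.
have [H|H] := ltnP (last i0 s).+1 (size mu); last by rewrite nth_default.
by rewrite leqNgt; apply: H3; rewrite ltnSn.
Qed.

Lemma rectw_knuth f mu p w : lattice (nth 0 mu) w ->
  rectw f mu (knuth p w) = knuth p (rectw f mu w).
Proof.
elim: f mu w => //= f IH mu w H; case E: filter => [|i0 s] //.
have Hr := lowest_row_corner E.
by rewrite slidew_knuth // IH // nth_remove_box; exact: lattice_slidew.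
Qed.

Lemma glue_fill la n w : glue la (fun _ _ => 0) n w = fill la n w.
Proof.
by apply: funext2 => i j; rewrite /glue; case: ifP => // /fill_inside ->.
Qed.

Lemma leq_nth_sumn s i : nth 0 s i <= sumn s.
Proof. by elim: s i => [|x s IH] [|i] //=; [exact: leq_addr | rewrite (leq_trans (IH i)) ?leq_addl]. Qed.

Lemma rect_loopS f m mu G : rect_loop f.+1 m mu G =
  if [seq i <- iota 0 (size mu) | 0 < nth 0 mu i] is i0 :: s then
    let r := last i0 s in let c := (nth 0 mu r).-1 in
    rect_loop f m (set_nth 0 mu r c) (slide m.+1 r c G)
  else G.
Proof. by []. Qed.

(** Each round removes one box of [mu], so with this fuel the loop stops only at the empty inner
    shape. *)
Lemma rect_loop_fill f mu w : sumn mu < f -> lattice (nth 0 mu) w ->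
  rect_loop f (size w) mu (fill (nth 0 mu) 1 w) = fill (fun=> 0) 1 (rectw f mu w).
Proof.
elim: f mu w => // f IH mu w Hf H.
rewrite rect_loopS [RHS]/=; case E: filter => [|i0 s].
  congr fill; apply: functional_extensionality => i.
  have [Hi|Hi] := ltnP i (size mu); last by rewrite nth_default.
  apply/eqP; rewrite eqn0Ngt; apply/negP => Hp.
  by have := in_nil i; rewrite -E mem_filter Hp mem_iota Hi.
have Hr := lowest_row_corner E.
cbv zeta; rewrite -glue_fill slide_glue // glue_fill -nth_remove_box.
rewrite -[X in rect_loop _ X](size_slidew (nth 0 mu) (last i0 s) w) IH //.
  rewrite sumn_set_nth0; have := leq_nth_sumn mu (last i0 s); lia.
by rewrite nth_remove_box; exact: lattice_slidew.
Qed.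

(** * Tableaux from row words *)

Fixpoint poss n i w : seq nat :=
  if w is r :: w' then
    if r == i then n :: poss n.+1 i w' else poss n.+1 i w'
  else [::].

(** The number of rows is recorded separately because empty rows leave no letter in [y]. *)
Definition tab_of mu N y : tab := (mu, mkseq (fun i => poss 1 i y) N).

Lemma mem_poss n i w x :
  (x \in poss n i w) = [&& n <= x, x < n + size w & nth 0 w (x - n) == i].
Proof.
elim: w n => [|r w IH] n /=; first by rewrite in_nil; lia.
have -> : (x \in if r == i then n :: poss n.+1 i w else poss n.+1 i w) =
  ((x == n) && (r == i)) || (x \in poss n.+1 i w).
  by case: ifP; rewrite ?inE ?andbT ?andbF.
rewrite IH; have [Hx|Hx] := ltnP n x.
  have -> : x - n = (x - n.+1).+1 by lia.
  by rewrite (ltnW Hx) addnS addSn [x == n]gtn_eqF.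
have [Hx'|Hx'] := ltnP x n; first by rewrite ltn_eqF.
have -> : x = n by lia.
by rewrite eqxx subnn addnS ltnS leq_addr orbF.
Qed.

Lemma poss_default N i w n : all (gtn N) w -> N <= i -> poss n i w = [::].
Proof.
elim: w n => //= r w IH n /andP[Hr Hw] Hi; rewrite IH // ifF //.
by apply/eqP => E; lia.
Qed.

Lemma poss_cat n i u v : poss n i (u ++ v) = poss n i u ++ poss (n + size u) i v.
Proof.
elim: u n => [|r u IH] n /=; first by rewrite addn0.
by rewrite IH addnS addSn; case: ifP.
Qed.

Lemma poss_shift c n i w : poss (c + n) i w = map (addn c) (poss n i w).
Proof. by elim: w n => //= r w IH n; rewrite -addnS IH; case: ifP. Qed.

Lemma size_poss n i w : size (poss n i w) = count_mem i w.
Proof. by elim: w n => //= r w IH n; case: ifP => E; rewrite /= IH. Qed.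

Lemma path_poss n i w k : k < n -> path ltn k (poss n i w).
Proof. by elim: w n k => //= r w IH n k Hk; case: ifP => /= ?; rewrite ?Hk /= IH //; lia. Qed.

Lemma sorted_poss n i w : sorted ltn (poss n i w).
Proof.
by elim: w n => //= r w IH n; case: ifP => // _; apply: path_poss.
Qed.

Lemma nth_poss la n w i j : la i <= j -> nth 0 (poss n i w) (j - la i) = fill la n w i j.
Proof.
elim: w la n => [|r w IH] la n H /=; first by rewrite nth_nil.
rewrite [i == r]eq_sym; case: eqP => [E|E] /=; last first.
  by rewrite -IH /add_box; [have -> : la i + (i == r) = la i by lia | lia].
subst r; case: eqP => [->|Hj]; first by rewrite subnn.
rewrite -IH /add_box eqxx ?addn1; last by lia.
by have -> : j - la i = (j - (la i).+1).+1 by lia.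
Qed.

Lemma rowT_tab_of mu N y i : all (gtn N) y -> rowT (tab_of mu N y) i = poss 1 i y.
Proof.
move=> H; rewrite /rowT /=; have [Hi|Hi] := ltnP i N; first by rewrite nth_mkseq.
by rewrite nth_default ?size_mkseq // (poss_default _ H).
Qed.

Lemma tab_fun_tab_of mu N y : all (gtn N) y ->
  tab_fun (tab_of mu N y) = fill (nth 0 mu) 1 y.
Proof.
move=> H; apply: funext2 => i j; rewrite /tab_fun /in_cell /entry rowT_tab_of // /offs /=.
have [Hj|Hj] := leqP (nth 0 mu i) j; last by rewrite fill_inside.
rewrite /= -(nth_poss 1 y Hj); case: ifP => // K.
by rewrite nth_default //; lia.
Qed.

Lemma ncells_tab_of mu N y : all (gtn N) y -> ncells (tab_of mu N y) = size y.
Proof.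
move=> H; rewrite /ncells /reading_word /= size_flatten /shape map_rev sumn_rev.
have : all (gtn N) y -> sumn (mkseq (fun i => count_mem i y) N) = size y.
  elim: y {H} => [|r y IH] /=; first by move=> _; elim: N => // N IH; rewrite mkseqS -cats1 sumn_cat IH.
  move=> /andP[Hr /IH <-].
  rewrite !sumnE !big_map big_split /= -add1n; congr (_ + _).
  rewrite -(big_map (fun i => r == i : nat) xpredT id) -sumnE.
  by rewrite sumn_count (eq_count (a2 := pred1 r)) ?count_uniq_mem ?iota_uniq // ?mem_iota 1?Hr // => i; rewrite /= eq_sym.
move=> /(_ H) <-; congr sumn; rewrite /mkseq -map_comp.
by apply: eq_map => i /=; rewrite size_poss.
Qed.

Lemma tab_power_tab_of mu N y k : all (gtn N) y ->
  tab_power (tab_of mu N y) k = tab_of mu N (wpow y k).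
Proof.
move=> H; rewrite /tab_power ncells_tab_of //; congr pair.
rewrite /= /mkseq -map_comp; apply: eq_map => i /=.
elim: k => // k IH; rewrite wpowSr poss_cat -IH size_wpow -[1 + _]addnC poss_shift.
by rewrite -[in iota _ _]addn1 iotaD map_cat flatten_cat /= cats0.
Qed.

(** The finite window read by [rect] loses nothing: slides never create a letter outside the first
    [N] rows, and no row has more than [size y] entries. *)
Lemma mem_rect mu N y i x : all (gtn N) y -> lattice (nth 0 mu) y ->
  (x \in nth [::] (rect (tab_of mu N y)) i) =
  (x \in poss 1 i (rectw (sumn mu).+1 mu y)).
Proof.
move=> H L; have HR := all_rectw (sumn mu).+1 mu H.
rewrite /rect ncells_tab_of // tab_fun_tab_of // rect_loop_fill //= size_mkseq.
set R := rectw _ _ _ in HR *; have SR : size R = size y := size_rectw _ _ _.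
have [Hi|Hi] := leqP N i.
  by rewrite (poss_default _ HR) // nth_default // size_map size_iota.
rewrite (nth_map 0) ?size_iota // nth_iota // add0n.
have E j : fill (fun=> 0) 1 R i j = nth 0 (poss 1 i R) j.
  by rewrite -(@nth_poss (fun=> 0) 1) // subn0.
apply/mapP/idP => [[j]|Hx].
  rewrite mem_filter E => /andP[Hj _] ->; apply: mem_nth.
  by rewrite ltnNge; apply: contra Hj => Hj; rewrite nth_default.
exists (index x (poss 1 i R)); last by rewrite E nth_index.
rewrite mem_filter E nth_index // mem_iota /=.
have := Hx; rewrite mem_poss => /andP[H0 _]; rewrite -lt0n H0 /= -SR.
by apply: (@leq_trans (size (poss 1 i R))); rewrite ?index_mem // size_poss count_size.
Qed.

Lemma stabilizes_tab_of mu N y k : all (gtn N) y -> lattice (nth 0 mu) (wpow y k.+1) ->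
  stabilizes_at (tab_of mu N y) k.+1 <->
  drop (k * size y) (rectw (sumn mu).+1 mu (wpow y k.+1)) = y.
Proof.
move=> H L; rewrite /stabilizes_at tab_power_tab_of // ncells_tab_of // [k.+1.-1]/=.
have HW := all_wpow k.+1 H; set R := rectw _ _ _.
have SR : size R = k.+1 * size y by rewrite size_rectw size_wpow.
have SD : size (drop (k * size y) R) = size y by rewrite size_drop SR; lia.
have memR x i : (x \in nth [::] (rect (tab_of mu N (wpow y k.+1))) i) = (x \in poss 1 i R).
  exact: mem_rect.
have W x : k * size y < x <= k.+1 * size y ->
  (forall i, (x \in poss 1 i R) = (nth 0 (drop (k * size y) R) (x - 1 - k * size y) == i)) /\
  (forall i, (x \in poss 1 i (wpow y k.+1)) = (nth 0 y (x - 1 - k * size y) == i)).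
  move=> Hx; split=> i; rewrite mem_poss ?size_wpow ?SR.
    rewrite nth_drop; have -> : k * size y + (x - 1 - k * size y) = x - 1 by lia.
    by case: (_ == i); lia.
  rewrite wpowSr nth_cat size_wpow ifF; last by lia.
  by case: (_ == i); lia.
split=> [Hs|E x Hx i].
  apply: (@eq_from_nth _ 0) => // j; rewrite SD => Hj.
  have Hx : k * size y < k * size y + j.+1 <= k.+1 * size y by lia.
  (* Testing the one row [nth 0 y j] already forces the two letters to agree. *)
  have [W1 W2] := W _ Hx; have := Hs _ Hx (nth 0 y j).
  rewrite memR rowT_tab_of // W1 W2.
  have -> : k * size y + j.+1 - 1 - k * size y = j by lia.
  by rewrite eqxx => /eqP.
by rewrite memR rowT_tab_of //; have [-> ->] := W x Hx; rewrite E.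
Qed.

Definition word_before y a b :=
  (nth 0 y b.-1 < nth 0 y a.-1) || ((nth 0 y a.-1 == nth 0 y b.-1) && (a < b)).

Lemma mem_reading_word mu N y x : all (gtn N) y ->
  (x \in reading_word (tab_of mu N y)) = (0 < x <= size y).
Proof.
move=> H; apply/flattenP/idP => [[s]|Hx].
  by rewrite mem_rev => /mapP[i _ ->]; rewrite mem_poss; lia.
exists (poss 1 (nth 0 y x.-1) y).
  have /(mem_nth 0)/(allP H) Hr : x.-1 < size y by lia.
  by rewrite mem_rev; apply: map_f; rewrite mem_iota.
by rewrite mem_poss subn1; lia.
Qed.

(** Induction on the number of rows: the bottom row heads the reading word, and within it entries
    increase. *)
Lemma index_reading_word mu N y a b :
  0 < a <= size y -> 0 < b <= size y -> nth 0 y a.-1 < N -> nth 0 y b.-1 < N ->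
  (index a (reading_word (tab_of mu N y)) < index b (reading_word (tab_of mu N y)))
  = word_before y a b.
Proof.
rewrite /reading_word /= => Ha Hb.
elim: N => // N IH; rewrite !ltnS => HaN HbN.
rewrite mkseqS rev_rcons /= !index_cat.
have Ma : (a \in poss 1 N y) = (nth 0 y a.-1 == N) by rewrite mem_poss subn1; lia.
have Mb : (b \in poss 1 N y) = (nth 0 y b.-1 == N) by rewrite mem_poss subn1; lia.
have La := index_mem a (poss 1 N y); have Lb := index_mem b (poss 1 N y).
rewrite Ma in La *; rewrite Mb in Lb *; rewrite /word_before.
case: (nth 0 y a.-1 =P N) La Ma => [Ea|Na] La Ma; case: (nth 0 y b.-1 =P N) Lb Mb => [Eb|Nb] Lb Mb.
- rewrite Ea Eb ltnn eqxx /=.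
  have S := sorted_poss 1 N y.
  have [Hab|Hba] := ltnP (index a (poss 1 N y)) (index b (poss 1 N y)).
    by have := sorted_ltn_index ltn_trans S a b Ma Mb Hab => /= ->.
  have [E|NE] := eqVneq a b; first by rewrite E ltnn.
  have : index b (poss 1 N y) < index a (poss 1 N y).
    rewrite ltn_neqAle Hba andbT; apply: contra NE => /eqP E.
    by rewrite -(nth_index 0 Ma) -(nth_index 0 Mb) E.
  by move/(sorted_ltn_index ltn_trans S b a Mb Ma) => /= ?; lia.
- by rewrite Ea; lia.
- by rewrite Eb; lia.
- by rewrite ltn_add2l IH //; lia.
Qed.

(** * Dual equivalence and stabilization *)

Lemma swapvC a b : swapv a b =1 swapv b a.
Proof. by move=> x; rewrite /swapv; case: (x =P a) => [->|]; case: (_ =P b). Qed.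

Lemma swap_entriesC a b T : swap_entries a b T = swap_entries b a T.
Proof. by congr pair; apply: eq_map => r; apply: eq_map; exact: swapvC. Qed.

(** If a = b, the entry swap would put a row out of order while the word stays the same. *)
Lemma swap_entries_tab_of mu N u v a b : a != b ->
  swap_entries (size u).+1 (size u).+2 (tab_of mu N (u ++ [:: a, b & v])) =
  tab_of mu N (u ++ [:: b, a & v]).
Proof.
move=> Hab; congr pair; rewrite /= /mkseq -map_comp; apply: eq_map => i /=.
rewrite !poss_cat map_cat /= !add1n; congr (_ ++ _).
  apply: map_id_in => x; rewrite mem_poss => /and3P[H1 H2 _].
  by rewrite /swapv !ifF //; lia.
have Hv : map (swapv (size u).+1 (size u).+2) (poss (size u).+3 i v) = poss (size u).+3 i v.
  apply: map_id_in => x; rewrite mem_poss => /and3P[H1 H2 _].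
  by rewrite /swapv !ifF //; lia.
have S1 : swapv (size u).+1 (size u).+2 (size u).+1 = (size u).+2 by rewrite /swapv eqxx.
have S2 : swapv (size u).+1 (size u).+2 (size u).+2 = (size u).+1.
  by rewrite /swapv eqxx ifF //; lia.
case: (a =P i) Hab => [->|_] Hab; case: (b =P i) => [E|_] //=; rewrite ?S1 ?S2 ?Hv //.
by rewrite E eqxx in Hab.
Qed.

(** Entries p+1, p+2, p+3 are letters p, p+1, p+2 counted from 0. The mix of strict and weak
    inequalities in [knuth] is the tie-break of [word_before] within a row. *)
Lemma dual_move_tab_of mu N y p : all (gtn N) y ->
  dual_move p.+2 (tab_of mu N y) = tab_of mu N (knuth p y).
Proof.
move=> H; rewrite /dual_move !mem_reading_word // [p.+2.-1]/=.
have [Hs|Hs] := leqP (size y) (p + 2).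
  rewrite knuth_short // ifF; last by apply/negP => /and5P[_ _ _ ? _]; lia.
  by rewrite ifF //; apply/negP => /and5P[_ _ _ ? _]; lia.
have [u [x1 [x2 [x3 [v [Ep Ey]]]]]] : exists u x1 x2 x3 v,
    p = size u /\ y = u ++ [:: x1, x2, x3 & v].
  exists (take p y); case E: (drop p y) => [|x1 [|x2 [|x3 v]]];
    try by move/(congr1 size): E; rewrite size_drop /=; lia.
  by exists x1, x2, x3, v; rewrite -E cat_take_drop size_takel //; lia.
have N1 : nth 0 y p = x1 by rewrite Ey Ep nth_cat ltnn subnn.
have N2 : nth 0 y p.+1 = x2 by rewrite Ey Ep nth_cat ltnNge leqnSn subSn ?subnn.
have N3 : nth 0 y p.+2 = x3.
  by rewrite Ey Ep nth_cat ltnNge (ltnW (leqnSn _)) /= -addn2 addKn.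
have Hlt i : i < size y -> nth 0 y i < N by move/(mem_nth 0)/(allP H).
have [L1 L2 L3] : [/\ x1 < N, x2 < N & x3 < N].
  by rewrite -N1 -N2 -N3; split; apply: Hlt; lia.
rewrite /between !index_reading_word ?N1 ?N2 ?N3 //=; try lia.
rewrite /word_before /= N1 N2 N3.
have -> : knuth p y = u ++ knuth 0 [:: x1, x2, x3 & v].
  by rewrite Ep Ey -{1}[size u]addn0 knuth_cat_right.
rewrite /=; have [K|K] := boolP ((x3 <= x1 < x2) || (x2 <= x1 < x3)).
  rewrite ifT; last by lia.
  rewrite Ey Ep -cat_rcons -[(size u).+1](size_rcons u x1) swap_entries_tab_of ?cat_rcons //; lia.
rewrite ifF; last by lia.
have [K'|K'] := boolP ((x1 < x3 <= x2) || (x2 < x3 <= x1)).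
  rewrite ifT; last by lia.
  by rewrite Ey Ep swap_entriesC swap_entries_tab_of //; lia.
by rewrite ifF -?Ey //; lia.
Qed.

Lemma foldr_knuth_cat ps u v : all (fun q => q + 2 < size u) ps ->
  foldr knuth (u ++ v) ps = foldr knuth u ps ++ v /\ size (foldr knuth u ps) = size u.
Proof.
elim: ps => //= q ps IH /andP[Hq /IH [-> E]].
by rewrite knuth_cat_left ?size_knuth E.
Qed.

(** The bound on [p] keeps each lifted move inside one copy; beyond it [knuth p] fixes [w], but a
    move on the power could straddle two copies. *)
Lemma wpow_knuth p w k : p + 2 < size w ->
  exists2 ps, all (fun q => q + 2 < k * size w) ps & foldr knuth (wpow w k) ps = wpow (knuth p w) k.
Proof.
move=> Hp; elim: k => [|k [ps Hps E]]; first by exists [::].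
have Hps' : all (fun q => q + 2 < size (wpow w k)) ps by rewrite size_wpow.
exists (k * size w + p :: ps) => /=.
  by apply/andP; split; [lia | apply: sub_all Hps => q; lia].
by rewrite !wpowSr (foldr_knuth_cat _ Hps').1 E -(size_knuth p w) -size_wpow knuth_cat_right.
Qed.

Lemma lattice_foldr_knuth la ps w : lattice la w -> lattice la (foldr knuth w ps).
Proof. by move=> H; elim: ps => //= q ps; exact: lattice_knuth. Qed.

Lemma rectw_foldr_knuth f mu ps w : lattice (nth 0 mu) w ->
  rectw f mu (foldr knuth w ps) = foldr knuth (rectw f mu w) ps.
Proof.
by move=> H; elim: ps => //= q ps <-; rewrite rectw_knuth //; exact: lattice_foldr_knuth.
Qed.

Definition last_block f mu w k := drop (k * size w) (rectw f mu (wpow w k.+1)).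

(** The moves lifted to the first k copies may act differently on the rectified word, but they stay
    within its first [k * size w] letters, which [drop] discards. *)
Lemma last_block_knuth f mu p w k : lattice (nth 0 mu) (wpow w k.+1) ->
  last_block f mu (knuth p w) k = knuth p (last_block f mu w k).
Proof.
move=> L; rewrite /last_block size_knuth.
have [Hp|Hp] := leqP (size w) (p + 2).
  by rewrite !knuth_short // size_drop size_rectw size_wpow; lia.
have [ps Hps E] := wpow_knuth k Hp.
set R := rectw f mu (wpow w k.+1).
have ST : size (take (k * size w) R) = k * size w.
  by rewrite size_takel // size_rectw size_wpow; lia.
have -> : wpow (knuth p w) k.+1 = knuth (k * size w + p) (foldr knuth (wpow w k.+1) ps).
  have Hps' : all (fun q => q + 2 < size (wpow w k)) ps by rewrite size_wpow.
  by rewrite !wpowSr (foldr_knuth_cat _ Hps').1 E -(size_knuth p w) -size_wpow knuth_cat_right.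
rewrite rectw_knuth; last exact: lattice_foldr_knuth.
rewrite rectw_foldr_knuth // -/R -{1}(cat_take_drop (k * size w) R).
have Hps' : all (fun q => q + 2 < size (take (k * size w) R)) ps by rewrite ST.
have [-> SF] := foldr_knuth_cat (drop (k * size w) R) Hps'.
by rewrite -{1 2}ST -SF knuth_cat_right drop_size_cat.
Qed.

(** The last clause is the row-length condition; it depends only on letter multiplicities, so Knuth
    moves preserve it. *)
Definition good_word mu N y :=
  [/\ all (gtn N) y, lattice (nth 0 mu) y & forall i, count_mem i.+1 y <= count_mem i y].

Lemma dual_equiv_tab_of S T mu N y : dual_equiv S T -> S = tab_of mu N y -> good_word mu N y ->
  exists y', [/\ T = tab_of mu N y', good_word mu N y' &
    forall f k, last_block f mu y' k = y' <-> last_block f mu y k = y].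
Proof.
move=> D; elim: D y => {S T} [T|S T i _ IH] y E Hy; first by exists y.
have {IH} [y' [ET [H1 H2 H3] Hk]] := IH y E Hy.
(* The guard [1 < i] makes the moves for 0 and 1 trivial. *)
case: i => [|[|p]]; try by exists y'.
exists (knuth p y'); split; first by rewrite ET dual_move_tab_of.
  split=> [||i]; first by rewrite (perm_all _ (perm_knuth p y')).
    exact: lattice_knuth.
  by rewrite !(permP (perm_knuth p y')).
move=> f k; rewrite -Hk last_block_knuth; last exact: lattice_wpow.
by split=> [/(can_inj (knuthK p))|->].
Qed.

(** * Row words of standard tableaux and the theorem *)

Lemma flatten_uniq_nth (ss : seq (seq nat)) x i j : uniq (flatten ss) ->
  x \in nth [::] ss i -> x \in nth [::] ss j -> i = j.
Proof.
elim: ss i j => [|s ss IH] [|i] [|j] //=; rewrite ?in_nil // cat_uniq => /and3P[_ N U].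
- move=> Hx Hj; case/hasP: N; exists x => //; apply/flattenP; exists (nth [::] ss j) => //.
  by apply: mem_nth; rewrite ltnNge; apply/negP => K; rewrite nth_default in Hj.
- move=> Hj Hx; case/hasP: N; exists x => //; apply/flattenP; exists (nth [::] ss i) => //.
  by apply: mem_nth; rewrite ltnNge; apply/negP => K; rewrite nth_default in Hj.
- by move=> Hi Hj; congr S; exact: IH.
Qed.

Lemma standard_tab_of T : standard_skew T ->
  exists y, [/\ T = tab_of (inner T) (size (trows T)) y, all (gtn (size (trows T))) y &
    lattice (nth 0 (inner T)) y].
Proof.
move=> [[Hs [Hmu Hla]] [Hperm [Hrow Hcol]]].
set m := ncells T in Hperm; set N := size (trows T).
have Hmem x : (x \in flatten (trows T)) = (0 < x <= m).
  have -> : (x \in flatten (trows T)) = (x \in reading_word T).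
    by apply: perm_mem; apply: perm_flatten; rewrite perm_sym perm_rev.
  by rewrite (perm_mem Hperm) mem_iota add1n ltnS.
have Huniq : uniq (flatten (trows T)).
  have -> : uniq (flatten (trows T)) = uniq (reading_word T).
    by apply: perm_uniq; apply: perm_flatten; rewrite perm_sym perm_rev.
  by rewrite (perm_uniq Hperm) iota_uniq.
pose row x := find (fun s => x \in s) (trows T).
pose y := [seq row x | x <- iota 1 m].
have Sy : size y = m by rewrite size_map size_iota.
have Hfind x : 0 < x <= m -> row x < N /\ x \in nth [::] (trows T) (row x).
  rewrite -Hmem => /flattenP[s Hs1 Hs2].
  have Hh : has (fun s => x \in s) (trows T) by apply/hasP; exists s.
  by split; [rewrite /row -has_find | exact: (nth_find [::] Hh)].
have Hall : all (gtn N) y.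
  by apply/allP => r /mapP[x]; rewrite mem_iota => Hx ->; apply: (Hfind x _).1; lia.
have HT : T = tab_of (inner T) N y.
  rewrite {1}[T]surjective_pairing; congr pair.
  apply: (@eq_from_nth _ [::]); rewrite ?size_mkseq // => i Hi; rewrite nth_mkseq //.
  apply: (irr_sorted_eq ltn_trans ltnn); [exact: Hrow | exact: sorted_poss |].
  move=> x; rewrite mem_poss Sy andbA.
  have [Hx|Hx] := boolP (0 < x < 1 + m); last first.
    apply/negP => Hin; case/negP: Hx; rewrite add1n ltnS -Hmem; apply/flattenP.
    by exists (nth [::] T.2 i) => //; exact: mem_nth.
  have [Hr1 Hr2] : row x < N /\ x \in nth [::] (trows T) (row x) by apply: Hfind; lia.
  rewrite /y (nth_map 0) ?size_iota ?nth_iota; try lia.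
  have -> : 1 + (x - 1) = x by lia.
  apply/idP/eqP => [Hin|<- //]; exact: flatten_uniq_nth Huniq Hr2 Hin.
exists y; split=> // n i; rewrite leqNgt; apply/negP => Hlt.
have Hr j : rowT T j = poss 1 j (take n y) ++ poss (1 + size (take n y)) j (drop n y).
  by rewrite HT rowT_tab_of // -poss_cat cat_take_drop.
have Hsz j : count_mem j (take n y) <= size (rowT T j) by rewrite Hr size_cat size_poss leq_addr.
have := Hmu i; have := Hla i; rewrite /offs => Hla' Hmu'.
(* The first column of row i not filled by the first n entries: its entry exceeds every one of them,
   while the cell below holds one of them, against column strictness. *)
set c := offs T i + count_mem i (take n y).
have C1 : in_cell T i c by rewrite /in_cell /c /offs; have := Hsz i.+1; lia.
have C2 : in_cell T i.+1 c by rewrite /in_cell /c /offs; have := Hsz i.+1; lia.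
have := Hcol i c C1 C2; apply/negP; rewrite -leqNgt.
have E2 : entry T i.+1 c \in poss 1 i.+1 (take n y).
  rewrite /entry Hr nth_cat size_poss ifT; last by rewrite /c /offs; lia.
  by apply: mem_nth; rewrite size_poss /c /offs; lia.
have E1 : entry T i c \in poss (1 + size (take n y)) i (drop n y).
  have K : c - offs T i = count_mem i (take n y) by rewrite /c; lia.
  have := C1; rewrite /in_cell Hr size_cat size_poss => C1'.
  rewrite /entry Hr nth_cat size_poss K ltnn subnn; apply: mem_nth.
  by move: C1' => /andP[_]; rewrite /c ltn_add2l -[X in X < _]addn0 ltn_add2l.
by move: E1 E2; rewrite !mem_poss => /and3P[? _ _] /and3P[_ ? _]; lia.
Qed.

Lemma is_stab_congr S T k :
  (forall j, 0 < j -> stabilizes_at S j <-> stabilizes_at T j) -> is_stab S k -> is_stab T k.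
Proof.
move=> E [H0 [H1 H2]]; split=> //; split; first exact/E.
by move=> j Hj /E K; apply: (H2 j Hj); apply: K; case/andP: Hj.
Qed.

Theorem mainTheorem5 (S T : tab) :
  standard_skew S -> standard_skew T -> same_shape S T ->
  rows_weakly_decreasing S -> rows_weakly_decreasing T ->
  dual_equiv S T ->
  forall k, is_stab S k <-> is_stab T k.
Proof.
move=> HS _ _ HrS _ D.
have [y [ES Hall HL]] := standard_tab_of HS.
set mu := inner S in ES HL; set N := size (trows S) in ES Hall.
have Hd i : count_mem i.+1 y <= count_mem i y.
  by have := HrS i; rewrite ES !rowT_tab_of // !size_poss.
have [y' [ET [Hall' HL' Hd'] Hk]] := dual_equiv_tab_of D ES (And3 Hall HL Hd).
have Hstab k : 0 < k -> stabilizes_at S k <-> stabilizes_at T k.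
  case: k => // k _; rewrite ES ET.
  rewrite !stabilizes_tab_of //; try exact: lattice_wpow.
  by split=> /Hk.
by move=> k; split; apply: is_stab_congr => j Hj; rewrite Hstab.
Qed.
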